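(* Let $p$ be an odd prime, $c\in\mathbb Z_p$ with $c(c^2+1)\not\equiv 0\pmod p$. Then $$\Big(\frac 2p\Big)\sum_{k=0}^{[p/4]}\binom{4k}{2k}\Big(\frac{c^2}{16(c^2+1)}\Big)^k\equiv\begin{cases}1\pmod p&\text{if } c\in Q_0(p),\\ c\pmod p&\text{if } c\in Q_1(p),\\ -1\pmod p&\text{if } c\in Q_2(p),\\ -c\pmod p&\text{if } c\in Q_3(p),\end{cases}$$ and $$\sum_{k=0}^{[p/4]}\binom{4k}{2k}\frac{1}{(16(c^2+1))^k}\equiv\begin{cases}1\pmod p&\text{if } c\in Q_0(p),\\ -\frac1c\pmod p&\text{if } c\in Q_1(p),\\ -1\pmod p&\text{if } c\in Q_2(p),\\ \frac1c\pmod p&\text{if } c\in Q_3(p).\end{cases}$$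
   Context: $[x]$ is the greatest integer $\le x$; $\mathbb Z_p$ is the set of rational numbers whose denominator is not divisible by $p$; $(\frac{\cdot}{p})$ is the Legendre symbol; $i=\sqrt{-1}$. Quartic Jacobi symbol: for a Gaussian prime $\pi\nmid 2$ and a Gaussian integer $\alpha$, $(\frac{\alpha}{\pi})_4$ is the unique element of $\{0,1,i,-1,-i\}$ congruent to $\alpha^{(N\pi-1)/4}$ modulo $\pi$. For an odd rational prime $p$, $(\frac{\alpha}{p})_4=\prod_j(\frac{\alpha}{\pi_j})_4$ where $p=\prod_j\pi_j$ is the factorization into Gaussian primes (so $(\frac\alpha p)_4$ with $p$ itself if $p\equiv3\pmod 4$, and $(\frac\alpha\pi)_4(\frac\alpha{\bar\pi})_4$ if $p=\pi\bar\pi\equiv1\pmod4$). For $m,n\in\mathbb Z_p$, $(\frac{m+ni}{p})_4$ is defined as $(\frac{\alpha}{p})_4$ for any Gaussian integer $\alpha\equiv m+ni\pmod p$ (this is well defined). For $r=0,1,2,3$, $Q_r(p)=\{c\in\mathbb Z_p:(\frac{c+i}{p})_4=i^r\}$. *)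

(* Defs.v *)
(* Gaussian integers are modelled inside algC (algebraic complex numbers). *)
From HB Require Import structures.
From mathcomp Require Import all_boot all_order all_algebra all_field.
Set Implicit Arguments. Unset Strict Implicit. Unset Printing Implicit Defensive.
Import Order.TTheory GRing.Theory Num.Theory.
Local Open Scope ring_scope.

(* z is a Gaussian integer: real and imaginary parts are rational integers *)
Definition isGI (z : algC) : bool := ('Re z \is a Num.int) && ('Im z \is a Num.int).

(* divisibility in Z[i] : pi | beta  <=>  beta = pi * gamma for a Gaussian integer gamma *)
Definition gdvd (pi beta : algC) : Prop := exists2 g : algC, isGI g & beta = pi * g.

(* congruence modulo pi in Z[i] *)
Definition gcong (alpha beta pi : algC) : Prop := gdvd pi (alpha - beta).

Definition gunit (u : algC) : Prop := isGI u /\ exists2 v, isGI v & u * v = 1.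

(* Gaussian prime (irreducible element of Z[i]) *)
Definition gprime (pi : algC) : Prop :=
  [/\ isGI pi, pi <> 0, ~ gunit pi &
      forall a b, isGI a -> isGI b -> pi = a * b -> gunit a \/ gunit b].

(* norm N(pi) = pi * conj(pi), as a natural number *)
Definition gnorm (pi : algC) : nat := Num.truncn (pi * pi^*).

(* quartic residue symbol (alpha/pi)_4 for a Gaussian prime pi not dividing 2:
   the unique u in {0,1,i,-1,-i} with alpha^((N pi - 1)/4) = u (mod pi) *)
Definition quartic_sym (alpha pi u : algC) : Prop :=
  u \in [:: 0; 1; 'i; -1; -'i] /\ gcong (alpha ^+ ((gnorm pi).-1 %/ 4)) u pi.

(* quartic Jacobi symbol (alpha/p)_4 = v for an odd rational prime p:
   v = prod_j (alpha/pi_j)_4 where p = prod_j pi_j is a factorization into Gaussian primes *)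
Definition quartic_jacobi (alpha : algC) (p : nat) (v : algC) : Prop :=
  exists s : seq (algC * algC),
    [/\ forall x, x \in s -> gprime x.1 /\ quartic_sym alpha x.1 x.2,
        \prod_(x <- s) x.1 = p%:R &
        v = \prod_(x <- s) x.2].

(* congruence of elements of Z_p modulo p: p divides the numerator of x - y *)
Definition ratcong (p : nat) (x y : rat) : Prop := (p%:Z %| numq (x - y))%Z.

(* x in Z_p *)
Definition inZloc (p : nat) (x : rat) : Prop := ~~ (p %| `|denq x|)%N.

(* Q_r(p) = { c in Z_p : ((c+i)/p)_4 = i^r }, where ((c+i)/p)_4 = (alpha/p)_4 for any
   Gaussian integer alpha = a + b i with a = c, b = 1 (mod p) *)
Definition inQ (r p : nat) (c : rat) : Prop :=
  inZloc p c /\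
  exists a b : int,
    [/\ ratcong p a%:~R c, ratcong p b%:~R 1 &
        quartic_jacobi (a%:~R + b%:~R * 'i) p ('i ^+ r)].

(* Legendre symbol (a/p) *)
Definition legendre (a : int) (p : nat) : int :=
  if (p%:Z %| a)%Z then 0
  else if [exists x : 'I_p, (p%:Z %| (x%:Z) ^+ 2 - a)%Z] then 1 else -1.

(* Main.v *)
(* Fix an algebraic closure of F_p and write p = 2n+1.  Since C(2j,j) = (-4)^j C(n,j) mod p
   for j <= n, we have C(4k,2k) = 16^k C(n,2k), so with y^2 = 16x the sum of C(4k,2k) x^k is
   ((1+y)^n + (1-y)^n)/2.  Choose u^2 = c+i and v^2 = c-i; then y = c/(uv) or y = 1/(uv), and
   1 + c/(uv) = (u+v)^2/(2uv), 1 + 1/(uv) = (u+iv)^2/(2iuv).  Hence the n-th powers become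
   (p-1)-st powers, which Frobenius evaluates through u^p and v^p, and (2/p) = 2^n is exactly
   the factor needed for the first sum.  The quartic symbol enters as u^n = i^r v^n (n even)
   or v^(n+1) = i^r u^(n+1) (n odd), and the two sums become
   (i^r (c+i) - i^(-r) (c-i))/(2i) and (i^r (c+i) + i^(-r) (c-i))/(2c). *)
Require Import Defs.
From HB Require Import structures.
From mathcomp Require Import all_boot all_order all_algebra all_field.
From mathcomp Require Import ring zify.
Import Order.TTheory GRing.Theory Num.Theory.
Local Open Scope ring_scope.

(** * Central binomial coefficients and their sums in characteristic [p = 2n+1] *)

Lemma intr_pchar_eq0 {L : nzRingType} {p : nat} (m : int) :
  p \in [pchar L] -> (m%:~R == 0 :> L) = (p%:Z %| m)%Z.
Proof.
move=> pL; rewrite dvdzE /= (dvdn_pcharf pL) [in LHS](intEsign m).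
by rewrite rmorphM rmorphXn rmorphN1 mulr_sign; case: ifP => _; rewrite ?oppr_eq0.
Qed.

(** Both sides satisfy the same first-order recurrence in [j]: since [2n = -1] in [L], the ratio
    [2(2j+1)/(j+1)] equals [-4(n-j)/(j+1)], and [j+1 <= n < p] is invertible. *)
Lemma bin_central_pchar {L : fieldType} {n j : nat} :
  n.*2.+1 \in [pchar L] -> (j <= n)%N ->
  'C(2 * j, j)%:R = 'C(n, j)%:R * (- 4) ^+ j :> L.
Proof.
move=> pL; elim: j => [|j IHj] ltjn; first by rewrite !bin0 mulr1.
have j1N0 : j.+1%:R != 0 :> L.
  by rewrite -(dvdn_pcharf pL) gtnNdvd // ltnS; lia.
have n2 : 2 * n%:R + 1 = 0 :> L.
  by have := pcharf0 pL; rewrite -addn1 natrD -mul2n natrM.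
apply: (mulfI j1N0).
have binL : j.+1%:R * 'C(n, j.+1)%:R = (n%:R - j%:R) * 'C(n, j)%:R :> L.
  by rewrite -natrB 1?ltnW // -!natrM mul_bin_left.
have binC : j.+1%:R * 'C(2 * j.+1, j.+1)%:R = 2 * (2 * j%:R + 1) * 'C(2 * j, j)%:R :> L.
  have e : (j.+1 * 'C(2 * j.+1, j.+1) = 2 * (2 * j + 1) * 'C(2 * j, j))%N.
    rewrite -mul_bin_diag (_ : (2 * j.+1).-1 = (2 * j).+1); last lia.
    have -> : 'C((2 * j).+1, j) = 'C((2 * j).+1, j.+1).
      by rewrite -bin_sub; [congr binomial; lia | lia].
    by rewrite -!mulnA [(j.+1 * _)%N](esym (mul_bin_diag (2 * j).+1 j)) addn1.
  by rewrite -natrM e !natrM natrD natrM.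
rewrite binC IHj ?(ltnW ltjn) // [RHS]mulrA binL exprS.
have -> : 2 * (2 * j%:R + 1) = (n%:R - j%:R) * (- 4) :> L.
  have -> : 2 * (2 * j%:R + 1) = (n%:R - j%:R) * (- 4) + 2 * (2 * n%:R + 1) :> L by ring.
  by rewrite n2 mulr0 addr0.
ring.
Qed.

Lemma sum_even_odd {V : nmodType} (f : nat -> V) (m : nat) :
  \sum_(i < m.*2) f i = \sum_(k < m) (f k.*2 + f k.*2.+1).
Proof.
elim: m => [|m IHm]; first by rewrite !big_ord0.
by rewrite doubleS !big_ord_recr /= IHm addrA.
Qed.

(** The two binomial expansions are paired by parity of the index: odd powers of [y] cancel and even
    ones double. *)
Lemma sum_bin4_pchar {L : fieldType} {n : nat} {x y : L} :
  n.*2.+1 \in [pchar L] -> y ^+ 2 = 16 * x ->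
  2 * (\sum_(k < (n.*2.+1 %/ 4).+1) 'C(4 * k, 2 * k)%:R * x ^+ k)
    = (1 + y) ^+ n + (1 - y) ^+ n.
Proof.
move=> pL y2; set m := (_ %/ 4)%N.
(* Here [m] is the integer part of [n/2], so the indices below [2(m+1)] cover [0..n]; the possible
   extra one has a vanishing binomial coefficient. *)
have lenm : (n.+1 <= m.+1.*2)%N by rewrite /m; lia.
have expand (z : L) : (1 + z) ^+ n = \sum_(i < m.+1.*2) 'C(n, i)%:R * z ^+ i.
  rewrite -(big_mkord xpredT (fun i => 'C(n, i)%:R * z ^+ i)) (big_cat_nat _ (n := n.+1)) //=.
  rewrite [X in _ = _ + X]big1_seq ?addr0 => [|i]; last first.
    by rewrite mem_index_iota => /andP[_ /andP[ni _]]; rewrite bin_small ?mul0r.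
  rewrite big_mkord exprDn; apply: eq_bigr => i _.
  by rewrite expr1n mul1r mulr_natl.
rewrite !expand.
rewrite !(sum_even_odd (fun i => 'C(n, i)%:R * _ ^+ i)) -big_split mulr_sumr.
apply: eq_bigr => k _ /=.
rewrite (_ : (4 * k = 2 * k.*2)%N) -?mul2n; last lia.
rewrite (bin_central_pchar pL); last by have := ltn_ord k; rewrite /m; lia.
rewrite exprS [(- y) ^+ _.+1]exprS !exprM !sqrrN.
rewrite y2 (_ : 16 = 4 ^+ 2 :> L); last ring.
by move: (4 : L) => q; rewrite !exprMn; ring.
Qed.

(** * Evaluation of the power sums by Frobenius *)

(** After Frobenius only [u], [v], [u ^+ n], [v ^+ n] and [w = io ^+ r] remain; [hr] eliminates
    [v ^+ n], and what is left is an identity of rational functions for each parity of [n]. *)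
Lemma power_sums_eval {L : fieldType} {n r : nat} {c io u v : L} :
  n.*2.+1 \in [pchar L] -> (0 < n)%N -> io ^+ 2 = -1 -> u ^+ 2 = c + io -> v ^+ 2 = c - io ->
  u != 0 -> v != 0 -> c != 0 ->
  (if odd n then v ^+ n.+1 = io ^+ r * u ^+ n.+1 else u ^+ n = io ^+ r * v ^+ n) ->
  let S z := (1 + z) ^+ n + (1 - z) ^+ n in
  2 ^+ n * S (c / (u * v)) / 2 = (io ^+ r * (c + io) - io ^- r * (c - io)) / (2 * io) /\
  S ((u * v)^-1) / 2 = (io ^+ r * (c + io) + io ^- r * (c - io)) / (2 * c).
Proof.
move=> pL n_gt0 io2 u2 v2 u0 v0 c0 hr S.
set p := n.*2.+1 in pL.
have io0 : io != 0 by rewrite -sqrf_eq0 io2 oppr_eq0 oner_eq0.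
have two0 : 2 != 0 :> L by rewrite -(dvdn_pcharf pL) /p gtnNdvd //; lia.
set w := io ^+ r in hr *.
have w0 : w != 0 by rewrite expf_neq0.
have frobD (a b : L) : (a + b) ^+ p = a ^+ p + b ^+ p.
  by rewrite -!(pFrobenius_autE pL) pFrobenius_autD_comm //; apply: mulrC.
have frobB (a b : L) : (a - b) ^+ p = a ^+ p - b ^+ p.
  by rewrite -!(pFrobenius_autE pL) pFrobenius_autB_comm //; apply: mulrC.
have half (a : L) : a != 0 -> (a ^+ 2) ^+ n = a ^+ p / a.
  by move=> a0; rewrite -exprM mul2n /p exprSr mulfK.
have iop : io ^+ p = (-1) ^+ n * io by rewrite /p exprSr -mul2n exprM io2.
have up : u ^+ p = (u ^+ n) ^+ 2 * u by rewrite /p exprSr -exprM muln2.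
have vp : v ^+ p = (v ^+ n) ^+ 2 * v by rewrite /p exprSr -exprM muln2.
have un0 : u ^+ n != 0 by rewrite expf_neq0.
have vn0 : v ^+ n != 0 by rewrite expf_neq0.
have ioE : io = (u ^+ 2 - v ^+ 2) / 2 by rewrite u2 v2; field.
have cE : c = (u ^+ 2 + v ^+ 2) / 2 by rewrite u2 v2; field.
(* [half] divides by its base, so [u + v], [u - v], [u + io v] and [u - io v] must be nonzero: the
   first two have product [2 io], the last two [2 c]. *)
have uDv : u + v != 0.
  by apply: contra_neq io0 => e; rewrite ioE subr_sqr e mulr0 mul0r.
have uBv : u - v != 0.
  by apply: contra_neq io0 => e; rewrite ioE subr_sqr e !mul0r.
have cE' : (u + io * v) * (u - io * v) = 2 * c.
  have -> : (u + io * v) * (u - io * v) = u ^+ 2 - io ^+ 2 * v ^+ 2 by ring.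
  by rewrite io2 cE; field.
have uDiv : u + io * v != 0.
  by apply: contra_neq c0 => e; apply: (mulfI two0); rewrite -cE' e mul0r mulr0.
have uBiv : u - io * v != 0.
  by apply: contra_neq c0 => e; apply: (mulfI two0); rewrite -cE' e !mulr0.
have s0 : (-1) ^+ n != 0 :> L by rewrite signr_eq0.
have io1 : 1 + io != 0.
  apply: contra_neq two0 => e.
  have -> : 2 = (1 + io) * (1 - io) - (-1 - io ^+ 2) :> L by ring.
  by rewrite e io2 subrr mul0r subr0.
have nE : (-1) ^+ n = (-1) ^+ odd n :> L by rewrite signr_odd.
rewrite -u2 -v2 -/w.
have uvN : (u * v) ^+ n != 0 by rewrite expf_neq0 // mulf_neq0.
have vnE : v ^+ n = if odd n then w * u ^+ n * u / v else u ^+ n / w.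
  case: ifP hr => _ hr; last by rewrite hr mulrAC mulfV // mul1r.
  by apply: (mulIf v0); rewrite mulfVK // -exprSr hr exprSr mulrA.
have w2 : (u ^+ 2 - v ^+ 2) != 0.
  by rewrite subr_sqr mulf_neq0.
split.
- have -> : 2 ^+ n * S (c / (u * v)) =
     (((u + v) ^+ 2) ^+ n + (-1) ^+ n * ((u - v) ^+ 2) ^+ n) / (u * v) ^+ n.
    rewrite /S mulrDr -!exprMn [RHS]mulrDl -(exprVn _ n) -!exprMn cE.
    by congr (_ ^+ n + _ ^+ n); field; rewrite u0 v0 two0.
  rewrite !half // frobD frobB up vp exprMn vnE nE.
  rewrite (_ : 2 * io = u ^+ 2 - v ^+ 2); last by rewrite ioE; field.
  by case: (odd n); field; rewrite ?u0 ?v0 ?w0 ?un0 ?uDv ?uBv ?two0 ?w2.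
(* As [2 io] is the square of [1 + io], Frobenius gives its [n]-th power as
   [(1 + (-1)^n io) / (1 + io)]. *)
- have two_io : (2 * io) ^+ n = if odd n then - io else 1.
    have -> : 2 * io = (1 + io) ^+ 2.
      by rewrite sqrrD io2 mul1r expr1n [1 + _]addrC addrK mulr_natl.
    rewrite half // frobD expr1n iop nE; apply: (mulIf io1); rewrite mulfVK //.
    case: (odd n); last by rewrite expr0; ring.
    by rewrite (_ : - io * (1 + io) = - io - io ^+ 2); [rewrite io2; ring | ring].
  (* Rationalising turns both denominators into the [2 c] of the claim. *)
  have divDiv (x : L) : x / (u + io * v) = x * (u - io * v) / (2 * c).
    by rewrite -cE'; field; rewrite uDiv uBiv.
  have divBiv (x : L) : x / (u - io * v) = x * (u + io * v) / (2 * c).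
    by rewrite -cE'; field; rewrite uDiv uBiv.
  have -> : S ((u * v)^-1) =
     (((u + io * v) ^+ 2) ^+ n + (-1) ^+ n * ((u - io * v) ^+ 2) ^+ n)
       / ((2 * io) ^+ n * (u * v) ^+ n).
    have dio : 2 * io = u ^+ 2 - v ^+ 2 by rewrite ioE; field.
    have eD : (u + io * v) ^+ 2 = 2 * io * (u * v + 1).
      rewrite mulrDr mulr1 {2}dio (_ : (u + io * v) ^+ 2
        = u ^+ 2 + 2 * io * (u * v) + io ^+ 2 * v ^+ 2); last ring.
      by rewrite io2; ring.
    have eB : (u - io * v) ^+ 2 = - (2 * io * (u * v - 1)).
      rewrite mulrBr mulr1 {2}dio (_ : (u - io * v) ^+ 2
        = u ^+ 2 - 2 * io * (u * v) + io ^+ 2 * v ^+ 2); last ring.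
      by rewrite io2; ring.
    rewrite /S eD eB -!exprMn [RHS]mulrDl -(exprVn _ n) -!exprMn.
    by congr (_ ^+ n + _ ^+ n); field; rewrite u0 v0 two0 io0.
  rewrite !half // frobD frobB two_io !exprMn divDiv divBiv iop up vp vnE nE.
(* For even [n] the cross terms contain [io ^+ 2], which [field] cannot replace by [-1]; the factors
   [1] match the goal after [(-1) ^+ 0] is simplified. For odd [n] no [io ^+ 2] survives. *)
have io2K (x y : L) : (x + 1 * io * y) * (u - io * v) / (2 * c)
      + 1 * ((x - 1 * io * y) * (u + io * v) / (2 * c)) = (x * u + y * v) / c.
    rewrite (_ : x * u + y * v = x * u - (-1) * y * v); last ring.
    by rewrite -io2; field; rewrite c0 two0.
  case: (odd n); rewrite ?expr0 ?expr1 ?io2K; field;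
    by rewrite ?u0 ?v0 ?w0 ?un0 ?two0 ?c0 ?oppr_eq0 ?io0.
Qed.

(** * The prime subfield and Euler's criterion *)

(** The polynomial [X^p - X] has at most [p] roots, and the images of [0..p-1] are already [p]
    distinct ones. *)
Lemma pFrobenius_fixed_nat {L : fieldType} {p : nat} (x : L) :
  p \in [pchar L] -> x ^+ p = x -> exists2 i : nat, (i < p)%N & x = i%:R.
Proof.
move=> pL xp; have p_gt1 := prime_gt1 (pcharf_prime pL).
pose rs : seq L := [seq i%:R | i <- iota 0 p].
have uniq_rs : uniq rs.
  rewrite map_inj_in_uniq ?iota_uniq // => i j.
  have ne (k l : nat) : (k < l < p)%N -> k%:R != l%:R :> L.
    move=> /andP[ltkl ltlp]; rewrite eq_sym -subr_eq0 -natrB 1?ltnW //.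
    by rewrite -(dvdn_pcharf pL) gtnNdvd ?subn_gt0 //; lia.
  rewrite !mem_iota !add0n /= => ip jp eq_ij.
  by case: (ltngtP i j) => // lt_ij; [have := ne i j | have := ne j i];
    rewrite lt_ij ?ip ?jp eq_ij eqxx => /(_ isT).
have size_q : size ('X^p - 'X : {poly L}) = p.+1.
  by rewrite size_polyDl size_polyXn // size_polyN size_polyX.
have [/mapP[i] | xNrs] := boolP (x \in rs).
  by rewrite mem_iota add0n => /andP[_ ip] ->; exists i.
have rootq (y : L) : y ^+ p = y -> root ('X^p - 'X) y.
  by move=> yp; rewrite rootE !hornerE yp subrr.
suff: (size (x :: rs) < size ('X^p - 'X : {poly L})%R)%N.
  by rewrite size_q /= size_map size_iota ltnn.
apply: max_poly_roots; rewrite -?size_poly_eq0 ?size_q //= ?xNrs // rootq //=.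
apply/allP => _ /mapP[i _ ->]; apply: rootq.
by rewrite -(pFrobenius_autE pL) pFrobenius_aut_nat.
Qed.

(** Euler's criterion: for nonzero [a], [a^n = s^(p-1)] equals [1] exactly when Frobenius fixes [s],
    that is, when the square root lies in the prime subfield. *)
Lemma legendre_euler {L : fieldType} {n : nat} (a : int) (s : L) :
  n.*2.+1 \in [pchar L] -> (0 < n)%N -> s ^+ 2 = a%:~R ->
  (legendre a n.*2.+1)%:~R = a%:~R ^+ n :> L.
Proof.
move=> pL n_gt0 s2; rewrite /legendre -(intr_pchar_eq0 a pL).
have [-> | a0] := eqVneq; first by rewrite expr0n; case: n n_gt0 {pL}.
have s0 : s != 0 by rewrite -sqrf_eq0 s2.
have half (t : L) : t != 0 -> (t ^+ 2) ^+ n = t ^+ n.*2.+1 / t.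
  by move=> t0; rewrite -exprM mul2n exprSr mulfK.
case: existsP => [[x] | noroot].
  rewrite -(intr_pchar_eq0 _ pL) rmorphB /= rmorphXn /= subr_eq0 => /eqP x2.
  have x0 : x%:Z%:~R != 0 :> L by rewrite -sqrf_eq0 x2.
  rewrite -x2 half // -(pFrobenius_autE pL) pFrobenius_aut_nat.
  by rewrite divff.
have an : (a%:~R ^+ n) ^+ 2 = 1 :> L.
  have := pFrobenius_aut_int pL a; rewrite pFrobenius_autE => ap.
  by rewrite -!exprM mulnC exprM half // ap divff.
move/eqP: an; rewrite sqrf_eq1 => /orP[/eqP an | /eqP ->]; last by rewrite mulrN1z.
case: noroot; have sp : s ^+ n.*2.+1 = s.
  by rewrite exprSr -mul2n exprM s2 an mul1r.
have [i ip si] := pFrobenius_fixed_nat s pL sp; exists (Ordinal ip).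
by rewrite -(intr_pchar_eq0 _ pL) rmorphB /= rmorphXn /= -s2 si subrr.
Qed.

(** * Reduction of [p]-integral rationals *)

(* [reduces_to x z]: [x] is a [p]-integral rational whose reduction in the field [L] of
   characteristic [p] is [z]. *)
Definition reduces_to {L : fieldType} (x : rat) (z : L) : Prop :=
  exists a b : int, [/\ b%:~R != 0 :> L, x = a%:~R / b%:~R & z = a%:~R / b%:~R].

Lemma reduces_int {L : fieldType} (m : int) : reduces_to m%:~R (m%:~R : L).
Proof. by exists m, 1; rewrite !divr1 oner_eq0. Qed.

Lemma reduces_nat {L : fieldType} (m : nat) : reduces_to m%:R (m%:R : L).
Proof. exact: (reduces_int m). Qed.

Lemma intr_rat_neq0 {L : fieldType} {b : int} : b%:~R != 0 :> L -> b%:~R != 0 :> rat.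
Proof. by apply: contra_neq => /eqP; rewrite intr_eq0 => /eqP ->. Qed.

Lemma reducesD {L : fieldType} {x y : rat} {z t : L} :
  reduces_to x z -> reduces_to y t -> reduces_to (x + y) (z + t).
Proof.
move=> [a [b [b0 -> ->]]] [a' [b' [b'0 -> ->]]].
have [b0q b'0q] := (intr_rat_neq0 b0, intr_rat_neq0 b'0).
exists (a * b' + a' * b), (b * b'); rewrite !rmorphD !rmorphM mulf_neq0 //=.
by split=> //; field; rewrite ?b0 ?b0q ?b'0 ?b'0q.
Qed.

Lemma reducesM {L : fieldType} {x y : rat} {z t : L} :
  reduces_to x z -> reduces_to y t -> reduces_to (x * y) (z * t).
Proof.
move=> [a [b [b0 -> ->]]] [a' [b' [b'0 -> ->]]].
exists (a * a'), (b * b'); rewrite !rmorphM mulf_neq0 //=.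
by rewrite !mulf_div.
Qed.

Lemma reducesN {L : fieldType} {x : rat} {z : L} :
  reduces_to x z -> reduces_to (- x) (- z).
Proof. by rewrite -mulN1r -[- z]mulN1r; apply: reducesM (reduces_int (-1)). Qed.

Lemma reducesV {L : fieldType} {x : rat} {z : L} :
  reduces_to x z -> z != 0 -> reduces_to x^-1 z^-1.
Proof.
move=> [a [b [b0 -> ->]]]; rewrite mulf_eq0 invr_eq0 negb_or => /andP[a0 _].
by exists b, a; rewrite !invf_div.
Qed.

Lemma reducesX {L : fieldType} {x : rat} {z : L} (k : nat) :
  reduces_to x z -> reduces_to (x ^+ k) (z ^+ k).
Proof.
move=> xz; elim: k => [|k IHk]; first exact: (reduces_nat 1).
by rewrite !exprS; apply: reducesM.
Qed.

Lemma reduces_sum {L : fieldType} (m : nat) (f : nat -> rat) (g : nat -> L) :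
  (forall k, reduces_to (f k) (g k)) ->
  reduces_to (\sum_(k < m) f k) (\sum_(k < m) g k).
Proof.
move=> fg; elim: m => [|m IHm]; first by rewrite !big_ord0; apply: (reduces_nat 0).
by rewrite !big_ord_recr; apply: reducesD.
Qed.

(** The way back from equalities in [L] to congruences: [x - y] is some [a / b] with [p] dividing
    [a] but not [b], so by primality [p] divides its reduced numerator too. *)
Lemma reduces_ratcong {L : fieldType} {p : nat} {x y : rat} {z : L} :
  p \in [pchar L] -> reduces_to x z -> reduces_to y z -> ratcong p x y.
Proof.
move=> pL xz yz; have := reducesD xz (reducesN yz); rewrite subrr /ratcong.
move: (x - y) => t [a [b [b0 tE /esym/eqP]]].
rewrite mulf_eq0 invr_eq0 (negPf b0) orbF (intr_pchar_eq0 a pL) => pa.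
have b0q := intr_rat_neq0 b0.
have numE : numq t * b = a * denq t.
  apply: (@intr_inj rat); rewrite !rmorphM /= numqE tE.
  by rewrite mulrAC [_ * b%:~R]mulrAC mulfK // mulrC [in RHS]mulrC.
have : (p%:Z %| numq t * b)%Z by rewrite numE dvdz_mulr.
rewrite !dvdzE abszM Euclid_dvdM ?(pcharf_prime pL) // => /orP[//|].
by move: b0; rewrite (intr_pchar_eq0 b pL) dvdzE => /negPf ->.
Qed.

Lemma ratcong_int_reduces {L : fieldType} {p : nat} {c : rat} (a : int) :
  p \in [pchar L] -> ratcong p a%:~R c -> reduces_to c (a%:~R : L).
Proof.
move=> pL; rewrite /ratcong; set t := _ - c => pt.
have p_pr := pcharf_prime pL.
(* The numerator of [t] is divisible by [p], so its denominator, being coprime to it, is not. *)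
have w0 : (denq t)%:~R != 0 :> L.
  rewrite (intr_pchar_eq0 _ pL) dvdzE; apply/negP => pd.
  have := coprime_num_den t; rewrite /coprime => /eqP g1.
  have := dvdn_gcd p `|numq t| `|denq t|; move: pt pd; rewrite !dvdzE g1 /= => -> ->.
  by rewrite dvdn1 => /eqP p1; rewrite p1 in p_pr.
exists (a * denq t - numq t), (denq t); split=> //.
  rewrite rmorphB rmorphM /= mulrBl mulfK ?intr_eq0 ?denq_neq0 //.
  by rewrite divq_num_den /t subKr.
have := intr_pchar_eq0 (numq t) pL; rewrite pt => /eqP n0.
by rewrite rmorphB rmorphM /= n0 subr0 mulfK.
Qed.

(** * Primes as sums of two squares *)

Lemma nat_sqrt_bounds (m : nat) : exists k, (k ^ 2 <= m < k.+1 ^ 2)%N.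
Proof.
elim: m => [|m [k kP]]; first by exists 0.
have [lt | ge] := ltnP m.+1 (k.+1 ^ 2); first by exists k; nia.
by exists k.+1; nia.
Qed.

(* Pigeonhole on a + x b mod p with 0 <= a, b <= sqrt p. *)
Lemma thue_two_squares {p x : nat} :
  prime p -> (p %| x ^ 2 + 1)%N -> exists a b : int, a ^+ 2 + b ^+ 2 = p%:Z.
Proof.
move=> p_pr px; have p_gt0 := prime_gt0 p_pr.
have [k /andP[kp pk]] := nat_sqrt_bounds p.
(* A prime is not a square. Strictness matters at the end: [a^2 + b^2 <= 2k^2 < 2p] leaves [p] as
   the only positive multiple of [p]. *)
have kp' : (k ^ 2 < p)%N.
  rewrite ltn_neqAle kp andbT; apply/eqP => pE.
  have [p_gt1 /(_ k)] := primeP p_pr; rewrite -pE dvdn_mulr // => /(_ isT)/orP[]/eqP kE; nia.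
pose f (ij : 'I_k.+1 * 'I_k.+1) : 'I_p := Ordinal (ltn_pmod (ij.1 + x * ij.2) p_gt0).
have /injectivePn[[i j] [[i' j'] ne /(congr1 val) /= /eqP]] : ~~ injectiveb f.
  apply/negP => /injectiveP/leq_card.
  by rewrite card_prod !card_ord leqNgt mulnn pk.
rewrite -eqz_nat -!modz_nat eqz_mod_dvd !PoszD !PoszM => pab.
pose a := i%:Z - i'%:Z; pose b := j%:Z - j'%:Z; exists a, b.
have {}pab : (p%:Z %| a + x%:Z * b)%Z.
  by congr (_ %| _)%Z: pab; rewrite /a /b; ring.
have a_le : a ^+ 2 <= (k ^ 2)%N%:Z.
  by have := ltn_ord i; have := ltn_ord i'; rewrite /a; nia.
have b_le : b ^+ 2 <= (k ^ 2)%N%:Z.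
  by have := ltn_ord j; have := ltn_ord j'; rewrite /b; nia.
have ab_gt0 : 0 < a ^+ 2 + b ^+ 2.
  rewrite lt0r addr_ge0 ?sqr_ge0 // andbT paddr_eq0 ?sqr_ge0 // !sqrf_eq0 !subr_eq0 !eqz_nat.
  by apply: contra ne => /andP[/eqP/val_inj-> /eqP/val_inj->].
have /dvdzP[m mE] : (p%:Z %| a ^+ 2 + b ^+ 2)%Z.
  rewrite (_ : a ^+ 2 + b ^+ 2 = (a + x%:Z * b) * (a - x%:Z * b) + b ^+ 2 * (x ^ 2 + 1)%N%:Z).
    by apply: rpredD; [apply: dvdz_mulr | apply: dvdz_mull].
  by rewrite PoszD -mulnn PoszM; ring.
suff m1 : m = 1 by rewrite mE m1 mul1r.
nia.
Qed.

(** * Gaussian integers and their reduction to [L] *)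

(* Reduction of Gaussian integers along i |-> [io]; junk outside Z[i]. *)
Definition gval {L : fieldType} (io : L) (z : algC) : L :=
  (Num.floor ('Re z))%:~R + io * (Num.floor ('Im z))%:~R.

Definition grect (a b : int) : algC := a%:~R + 'i * b%:~R.

Lemma Re_grect a b : 'Re (grect a b) = a%:~R.
Proof. by rewrite Re_rect ?realz. Qed.

Lemma Im_grect a b : 'Im (grect a b) = b%:~R.
Proof. by rewrite Im_rect ?realz. Qed.

Lemma isGI_grect a b : isGI (grect a b).
Proof. by rewrite /isGI Re_grect Im_grect !intr_int. Qed.

Lemma isGIP {z : algC} : isGI z -> exists a b, z = grect a b.
Proof.
by case/andP=> /intrP[a ra] /intrP[b ib]; exists a, b; rewrite [z]Crect ra ib.
Qed.

Lemma gval_grect {L : fieldType} (io : L) a b : gval io (grect a b) = a%:~R + io * b%:~R.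
Proof. by rewrite /gval Re_grect Im_grect !intrKfloor. Qed.

Lemma grectM a b c d : grect a b * grect c d = grect (a * c - b * d) (a * d + c * b).
Proof. by rewrite /grect mulC_rect rmorphB rmorphD !rmorphM. Qed.

Lemma grectB a b c d : grect a b - grect c d = grect (a - c) (b - d).
Proof. by rewrite /grect subC_rect !rmorphB. Qed.

Lemma grect_int a : grect a 0 = a%:~R.
Proof. by rewrite /grect mulr0 addr0. Qed.

(* [gnorm] alone would denote the multirule of that name in MathComp's group library. *)
Lemma gnorm_grect a b : (Defs.gnorm (grect a b))%:Z = a ^+ 2 + b ^+ 2.
Proof.
rewrite /Defs.gnorm /grect conjC_rect ?realz // mulrC -subr_sqr exprMn sqrCi mulN1r opprK.
rewrite -!rmorphXn -rmorphD /=.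
have : 0 <= a ^+ 2 + b ^+ 2 by rewrite addr_ge0 ?sqr_ge0.
by case: (_ + _) => // m _; rewrite natrK.
Qed.

Lemma isGIM x y : isGI x -> isGI y -> isGI (x * y).
Proof.
by move=> /isGIP[a [b ->]] /isGIP[c [d ->]]; rewrite grectM isGI_grect.
Qed.

Lemma isGI_prod (s : seq algC) : all isGI s -> isGI (\prod_(x <- s) x).
Proof.
elim: s => [_|x s IHs /andP[xGI sGI]]; last by rewrite big_cons isGIM ?IHs.
by rewrite big_nil -(grect_int 1 : _ = 1) isGI_grect.
Qed.

Lemma gnormM {x y} : isGI x -> isGI y -> Defs.gnorm (x * y) = (Defs.gnorm x * Defs.gnorm y)%N.
Proof.
move=> /isGIP[a [b ->]] /isGIP[c [d ->]]; rewrite grectM.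
by apply/eqP; rewrite -eqz_nat PoszM !gnorm_grect; apply/eqP; ring.
Qed.

Lemma gnorm1_unit {z} : isGI z -> Defs.gnorm z = 1%N -> gunit z.
Proof.
move=> zGI z1; split=> //; case/isGIP: zGI z1 => a [b ->] /(congr1 Posz).
rewrite gnorm_grect => ab1; exists (grect a (- b)); first exact: isGI_grect.
rewrite grectM -[RHS](grect_int 1 : _ = 1); congr grect; last ring.
by apply: etrans ab1; ring.
Qed.

Lemma gval_sub {L : fieldType} (io : L) {x y} :
  isGI x -> isGI y -> gval io (x - y) = gval io x - gval io y.
Proof.
move=> /isGIP[a [b ->]] /isGIP[c [d ->]]; rewrite grectB !gval_grect !rmorphB; ring.
Qed.

Lemma gval_mul {L : fieldType} {io : L} {x y} : io ^+ 2 = -1 ->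
  isGI x -> isGI y -> gval io (x * y) = gval io x * gval io y.
Proof.
move=> io2 /isGIP[a [b ->]] /isGIP[c [d ->]]; rewrite grectM !gval_grect.
rewrite rmorphB rmorphD !rmorphM /= -[_ - _]/(_ + - _) -mulN1r -io2; ring.
Qed.

Lemma gval_exp {L : fieldType} {io : L} {x} k : io ^+ 2 = -1 ->
  isGI x -> isGI (x ^+ k) /\ gval io (x ^+ k) = gval io x ^+ k.
Proof.
move=> io2 xGI; elim: k => [|k [xkGI xkE]].
  by rewrite !expr0 -(grect_int 1 : _ = 1) isGI_grect gval_grect mulr0 addr0.
by rewrite !exprS isGIM // gval_mul // xkE.
Qed.

(** Turns the congruence defining the quartic symbol into an equation in [L]. *)
Lemma gcong_gval {L : fieldType} {io : L} {x y z} : io ^+ 2 = -1 ->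
  isGI x -> isGI y -> isGI z -> gval io z = 0 -> gcong x y z ->
  gval io x = gval io y.
Proof.
move=> io2 xGI yGI zGI z0 [g gGI xyE]; apply/eqP; rewrite -subr_eq0.
by rewrite -gval_sub // xyE gval_mul // z0 mul0r.
Qed.

(** * Factorization of [p] into Gaussian primes *)

(** Norms decide: [p] has norm [p^2], and each prime factor has a norm greater than 1 dividing
    [p^2], hence a multiple of [p]. So there are at most two factors, and two factors have norm [p]
    each. *)
Lemma gprime_factorization {p : nat} {s : seq algC} :
  prime p -> (forall x, x \in s -> gprime x) -> \prod_(x <- s) x = p%:R ->
  s = [:: p%:R] \/
  exists a b : int, a ^+ 2 + b ^+ 2 = p%:Z /\ s = [:: grect a b; grect a (- b)].
Proof.
move=> p_pr; have p0 : p%:R != 0 :> algC by rewrite pnatr_eq0 -lt0n prime_gt0.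
have normp : Defs.gnorm (p%:R) = (p ^ 2)%N.
  apply/eqP; rewrite -eqz_nat -[p%:R](grect_int p : _ = p%:R) gnorm_grect; apply/eqP; ring.
have norm_gt1 x : gprime x -> isGI x /\ (1 < Defs.gnorm x)%N.
  case=> xGI x0 xNu _; split=> //; rewrite ltn_neqAle lt0n eq_sym.
  apply/andP; split; first by apply/eqP => x1; apply: xNu; apply: gnorm1_unit.
  apply/eqP => x1; case: x0; case/isGIP: xGI x1 => a [b ->] /(congr1 Posz).
  rewrite gnorm_grect => /eqP; rewrite paddr_eq0 ?sqr_ge0 // !sqrf_eq0.
  by case/andP=> /eqP-> /eqP->; rewrite grect_int.
case: s => [_|x [sP|y s sP]].
- rewrite big_nil => /esym/eqP; rewrite pnatr_eq1 => /eqP p1.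
  by rewrite p1 in p_pr.
- by rewrite big_seq1 => ->; left.
rewrite !big_cons => prodE; right.
have sGI : all isGI s.
  by apply/allP => z zs; have [] // := norm_gt1 z; apply: sP; rewrite !inE zs !orbT.
have [xGI x_gt1] := norm_gt1 x (sP x (mem_head _ _)).
have [yGI y_gt1] : isGI y /\ (1 < Defs.gnorm y)%N.
  by apply: norm_gt1; apply: sP; rewrite !inE eqxx orbT.
have := normp; rewrite -prodE !gnormM ?isGIM ?isGI_prod // => normE.
have normEp u : (1 < Defs.gnorm u)%N -> (Defs.gnorm u %| p ^ 2)%N -> (p %| Defs.gnorm u)%N.
  move=> u_gt1 /(dvdn_pfactor _ _ p_pr)[[|m] _ uE]; first by rewrite uE in u_gt1.
  by rewrite uE expnS dvdn_mulr.
have /dvdnP[kx xE] : (p %| Defs.gnorm x)%N by rewrite normEp // -normE dvdn_mulr.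
have /dvdnP[ky yE] : (p %| Defs.gnorm y)%N by rewrite normEp // -normE mulnCA dvdn_mulr.
have p_gt0 := prime_gt0 p_pr.
have norm_s : (kx * (ky * Defs.gnorm (\prod_(z <- s) z)%R) = 1)%N.
  apply/eqP; rewrite -(eqn_pmul2l (m := p ^ 2)) ?expn_gt0 ?p_gt0 // muln1 -[X in _ == X]normE xE yE.
  by apply/eqP; ring.
case: s sP sGI prodE norm_s {normE} => [|z s] sP sGI prodE; last first.
  have [zGI z_gt1] : isGI z /\ (1 < Defs.gnorm z)%N.
    by apply: norm_gt1; apply: sP; rewrite !inE eqxx !orbT.
  have {}sGI : isGI (\prod_(w <- s) w) by apply: isGI_prod; case/andP: sGI.
  rewrite big_cons gnormM // => /eqP; rewrite !muln_eq1 => /and3P[_ _ /andP[/eqP z1 _]].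
  by rewrite z1 in z_gt1.
move=> /eqP; rewrite muln_eq1 => /andP[/eqP kx1 _]; move: xE; rewrite kx1 mul1n.
case/isGIP: xGI prodE => a [b ->]; rewrite big_nil mulr1 => prodE /(congr1 Posz).
rewrite gnorm_grect => abp; exists a, b; split=> //; congr [:: _; _].
(* The conjugate of the first factor also multiplies it to [p], so cancellation identifies the
   second factor. *)
have x0 : grect a b != 0 by apply: contra_neq p0 => x0; rewrite -prodE x0 mul0r.
apply: (mulfI x0); rewrite prodE grectM -[LHS](grect_int p : _ = p%:R) -abp; congr grect; ring.
Qed.

(** [p] is the product of [a + bi] and [a - bi], both of norm [p], so neither is a unit. *)
Lemma gprime_not_sum_squares {p : nat} {a b : int} :
  prime p -> a ^+ 2 + b ^+ 2 = p%:Z -> ~ gprime p%:R.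
Proof.
move=> p_pr abp [_ _ _ /(_ (grect a b) (grect a (- b)) (isGI_grect _ _) (isGI_grect _ _))].
have norm_unit (u : algC) : gunit u -> Defs.gnorm u = 1%N.
  case=> uGI [v vGI uv1]; have := gnormM uGI vGI; rewrite uv1.
  have -> : Defs.gnorm 1 = 1%N.
    by apply/eqP; rewrite -eqz_nat -(grect_int 1 : _ = 1) gnorm_grect.
  by move=> /esym/eqP; rewrite muln_eq1 => /andP[/eqP].
have norm_not1 (d : int) : d ^+ 2 = b ^+ 2 -> ~ gunit (grect a d).
  move=> db /norm_unit /(congr1 Posz); rewrite gnorm_grect db abp => -[p1].
  by rewrite p1 in p_pr.
have -> : p%:R = grect a b * grect a (- b).
  by rewrite grectM -[LHS](grect_int p : _ = p%:R) -abp; congr grect; ring.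
by case=> //; apply: norm_not1; rewrite ?sqrrN.
Qed.

(** Squares are 0 or 1 modulo 4, so an odd sum of two squares is 1 modulo 4. *)
Lemma sum_squares_even {n : nat} {a b : int} :
  a ^+ 2 + b ^+ 2 = n.*2.+1%:Z -> ~~ odd n.
Proof.
have sq4 (d : int) : exists m, d ^+ 2 = 4 * m \/ d ^+ 2 = 4 * m + 1.
  have [q [dE | dE]] : exists q, d = 2 * q \/ d = 2 * q + 1.
  - by exists (d %/ 2)%Z; lia.
  - by exists (q ^+ 2); left; rewrite dE; ring.
  by exists (q ^+ 2 + q); right; rewrite dE; ring.
by have [s []->] := sq4 a; have [t []->] := sq4 b; lia.
Qed.

(** For even [n] Frobenius fixes [io], so [-1] is a square modulo [p] and Thue's argument
    applies. *)
Lemma sqrtN1_two_squares {L : fieldType} {n : nat} {io : L} :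
  n.*2.+1 \in [pchar L] -> io ^+ 2 = -1 -> ~~ odd n ->
  exists a b : int, a ^+ 2 + b ^+ 2 = n.*2.+1%:Z.
Proof.
move=> pL io2 n_even; have iop : io ^+ n.*2.+1 = io.
  by rewrite exprSr -mul2n exprM io2 -signr_odd (negPf n_even) mul1r.
have [x _ xE] := pFrobenius_fixed_nat io pL iop.
apply: (thue_two_squares (x := x) (pcharf_prime pL)).
by rewrite (dvdn_pcharf pL) natrD natrX -xE io2 addNr.
Qed.

(** * The quartic symbol as a power in [L] *)

Lemma imaginaryC_grect : 'i = grect 0 1.
Proof. by rewrite /grect add0r mulr1. Qed.

Lemma gval_imaginaryX {L : fieldType} {io : L} (k : nat) :
  io ^+ 2 = -1 -> isGI ('i ^+ k) /\ gval io ('i ^+ k) = io ^+ k.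
Proof.
move=> io2; have [] := gval_exp (x := 'i) k io2.
  by rewrite imaginaryC_grect isGI_grect.
by move=> iGI ->; rewrite {2}imaginaryC_grect gval_grect mulr1 add0r.
Qed.

Lemma quartic_symE {alpha pi u : algC} :
  quartic_sym alpha pi u -> u != 0 -> exists k, u = 'i ^+ k.
Proof.
case=> + _; rewrite !inE => /or4P[/eqP->|/eqP->|/eqP->|/orP[]/eqP->].
- by rewrite eqxx.
- by exists 0.
- by exists 1.
- by exists 2; rewrite sqrCi.
- by exists 3; rewrite exprS sqrCi mulrN1.
Qed.

Lemma quartic_sym_gval {L : fieldType} {io : L} {a b : int} {k : nat} {z : algC} :
  io ^+ 2 = -1 -> isGI z -> gval io z = 0 ->
  quartic_sym (grect a b) z ('i ^+ k) ->
  (a%:~R + io * b%:~R) ^+ ((Defs.gnorm z).-1 %/ 4) = io ^+ k.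
Proof.
move=> io2 zGI z0 [_ cong].
have [ikGI <-] := gval_imaginaryX k io2.
have [aGI aE] := gval_exp ((Defs.gnorm z).-1 %/ 4) io2 (isGI_grect a b).
by rewrite -gval_grect -aE (gcong_gval io2 aGI ikGI zGI).
Qed.

(** If [p] stays prime in [Z[i]], the exponent is [(p^2-1)/4] and Frobenius exchanges [c + io] and
    [c - io]. If [p] splits, each factor contributes the exponent [(p-1)/4 = n/2], one read at [io],
    the other at [-io]. The choice of [io] may depend on the factorization, hence the
    existential. *)
Lemma quartic_jacobi_power {L : fieldType} {n r : nat} {io0 : L} {a b : int} :
  n.*2.+1 \in [pchar L] -> io0 ^+ 2 = -1 -> b%:~R = 1 :> L ->
  a%:~R ^+ 2 + 1 != 0 :> L ->
  quartic_jacobi (a%:~R + b%:~R * 'i) n.*2.+1 ('i ^+ r) ->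
  let c := a%:~R in
  exists2 io : L, io ^+ 2 = -1 &
    if odd n then (c - io) ^+ n.+1./2 = io ^+ r * (c + io) ^+ n.+1./2
    else (c + io) ^+ n./2 = io ^+ r * (c - io) ^+ n./2.
Proof.
set p := n.*2.+1 => pL io02 b1 c0 [s [sP s_prod s_val]] c.
have p_pr := pcharf_prime pL.
rewrite [_ * 'i]mulrC -/(grect a b) in sP.
have := gprime_factorization (s := [seq x.1 | x <- s]) p_pr.
rewrite big_map => /(_ _ s_prod) [x /mapP[y ys ->]|sE|[d [e [dep sE]]]].
- by have [] := sP y ys.
- case: s sE sP s_val {s_prod} => [//|[x u] [|//]] [->] sP.
  rewrite big_seq1 /= => uE; have [pG pS] := sP _ (mem_head _ _).
  rewrite -uE /= in pG pS.
  have n_odd : odd n.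
    apply/negP => /negP/(sqrtN1_two_squares pL io02)[d [e dep]].
    exact: gprime_not_sum_squares p_pr dep pG.
  exists io0 => //; rewrite n_odd.
  have pGI : isGI p%:R by case: pG.
  have p0 : gval io0 p%:R = 0.
    by rewrite -(grect_int p : _ = p%:R) gval_grect mulr0 addr0 -(pcharf0 pL).
  have := quartic_sym_gval io02 pGI p0 pS.
  have -> : (Defs.gnorm p%:R = p ^ 2)%N.
    apply/eqP; rewrite -eqz_nat -[p%:R](grect_int p : _ = p%:R) gnorm_grect; apply/eqP; ring.
  (* With [p - 1 = 2n] and [(p+1)/4 = (n+1)/2], the exponent splits so that an inner power [p - 1]
     is exposed; one more factor [c + io] completes it to [p]. *)
  rewrite (_ : (p ^ 2).-1 %/ 4 = n * 2 * n.+1./2)%N; last first.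
    rewrite -[RHS](mulnK _ (isT : (0 < 4)%N)); congr (_ %/ _)%N.
    have := odd_double_half n; rewrite n_odd /p => <-; move: (n./2) => m.
    rewrite add1n (_ : m.*2.+2./2 = m.+1); last lia.
    by rewrite -mulnn; lia.
  rewrite b1 mulr1 -/c exprM => <-.
  have cp : c ^+ p = c by rewrite -(pFrobenius_autE pL) pFrobenius_aut_int.
  have iop : io0 ^+ p = - io0.
    by rewrite /p exprSr -mul2n exprM io02 -signr_odd n_odd mulN1r.
  rewrite -exprMn; congr (_ ^+ _).
  rewrite muln2 -exprSr -/p -(pFrobenius_autE pL) pFrobenius_autD_comm; last exact: mulrC.
  by rewrite !pFrobenius_autE cp iop.
have n_even := sum_squares_even dep; rewrite (negPf n_even).
(* The two Gaussian primes over p are the kernels of i |-> io and i |-> - io; the sign of io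
   is chosen so that the first listed one is the kernel of i |-> io. *)
have [io io2 io_root] : exists2 io : L, io ^+ 2 = -1 & gval io (grect d e) = 0.
  have : (d%:~R + io0 * e%:~R) * (d%:~R - io0 * e%:~R) = 0 :> L.
    rewrite mulrC -subr_sqr exprMn io02 mulN1r opprK -!rmorphXn -rmorphD dep.
    exact: pcharf0 pL.
  move=> /eqP; rewrite mulf_eq0 => /orP[]/eqP.
    by exists io0; rewrite ?gval_grect.
  by exists (- io0); rewrite ?sqrrN ?gval_grect ?mulNr.
have Nio2 : (- io) ^+ 2 = -1 by rewrite sqrrN.
exists io => //.
case: s sE sP s_val {s_prod} => [//|[x u] [//|[y v] [|//]]] [-> ->] sP.
rewrite big_cons big_seq1 /= => uvE.
have [_ /= uS] := sP _ (mem_head _ _).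
have [_ /= vS] : gprime (grect d (- e)) /\ quartic_sym (grect a b) (grect d (- e)) v.
  by apply: (sP (_, v)); rewrite !inE eqxx orbT.
have : u * v != 0 by rewrite -uvE expf_neq0 ?neq0Ci.
rewrite mulf_eq0 negb_or => /andP[u0 v0].
have [[k uE] [l vE]] := (quartic_symE uS u0, quartic_symE vS v0).
rewrite uE in uS uvE; rewrite vE in vS uvE.
have uval := quartic_sym_gval io2 (isGI_grect _ _) io_root uS.
have Nio_root : gval (- io) (grect d (- e)) = 0.
  by rewrite -io_root !gval_grect rmorphN mulrNN.
have vval := quartic_sym_gval Nio2 (isGI_grect _ _) Nio_root vS.
have normE (f : int) : f ^+ 2 = e ^+ 2 -> ((Defs.gnorm (grect d f)).-1 %/ 4 = n./2)%N.
  move=> fe; have -> : Defs.gnorm (grect d f) = p.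
    by apply/eqP; rewrite -eqz_nat gnorm_grect fe dep.
  by rewrite /p; move: n_even; lia.
move: uval vval; rewrite !normE ?sqrrN // b1 !mulr1 -/c => -> ->.
have -> : io ^+ r = io ^+ k * io ^+ l.
  have [_ <-] := gval_imaginaryX r io2; rewrite uvE.
  have [kGI <-] := gval_imaginaryX k io2; have [lGI <-] := gval_imaginaryX l io2.
  by rewrite gval_mul.
(* The powers of [c + io] and [c - io] are [io ^+ k] and [(- io) ^+ l]; since [io * (- io) = 1], the
   factor [io ^+ l] cancels. *)
by rewrite -mulrA -exprMn mulrN -expr2 io2 opprK expr1n mulr1.
Qed.

(** * Assembly of the two congruences *)

Lemma closed_sqrt {L : closedFieldType} (x : L) : exists s, s ^+ 2 = x.
Proof.
have [s sE] := solve_monicpoly (fun i => if i == 0 then x else 0) (n := 2) isT.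
by exists s; rewrite sE !big_ord_recl big_ord0 /= expr0 mulr1 mul0r !addr0.
Qed.

Lemma sums_reduction {L : closedFieldType} {p r : nat} {c : rat} :
  p \in [pchar L] -> odd p -> ~ ratcong p (c * (c ^+ 2 + 1)) 0 -> inQ r p c ->
  exists g io : L,
  [/\ reduces_to c g, g != 0, io ^+ 2 = -1,
      reduces_to ((legendre 2 p)%:~R *
        \sum_(k < (p %/ 4).+1) ('C(4 * k, 2 * k))%:R * (c ^+ 2 / (16 * (c ^+ 2 + 1))) ^+ k)
        ((io ^+ r * (g + io) - io ^- r * (g - io)) / (2 * io)) &
      reduces_to (\sum_(k < (p %/ 4).+1) ('C(4 * k, 2 * k))%:R / (16 * (c ^+ 2 + 1)) ^+ k)
        ((io ^+ r * (g + io) + io ^- r * (g - io)) / (2 * g))].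
Proof.
move=> + p_odd.
have -> : p = (p./2).*2.+1 by rewrite -{1}(odd_double_half p) p_odd.
move: (p./2) => n {p p_odd} pL cN0 [_ [a [b [ac b1 jac]]]].
set g : L := a%:~R; exists g.
have cg : reduces_to c g := ratcong_int_reduces a pL ac.
have n_gt0 : (0 < n)%N by case: n pL {cN0 ac b1 jac} => [/pcharf_prime|].
have two0 : 2 != 0 :> L by rewrite -(dvdn_pcharf pL) gtnNdvd //; lia.
have c21 : reduces_to (c ^+ 2 + 1) (g ^+ 2 + 1) := reducesD (reducesX 2 cg) (reduces_nat 1).
have [g0 g21] : g != 0 /\ g ^+ 2 + 1 != 0.
  apply/andP; rewrite -negb_or -mulf_eq0; apply/negP => /eqP gE; apply: cN0.
  by apply: (reduces_ratcong pL (z := 0) _ (reduces_nat 0)); rewrite -gE; apply: reducesM.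
have {}b1 : b%:~R = 1 :> L.
  have := ratcong_int_reduces b pL b1 => -[d [e [e0 /eqP]]].
  rewrite eq_sym; have e0q := intr_rat_neq0 e0.
  rewrite (can2_eq (mulfVK e0q) (mulfK e0q)) mul1r eqr_int => /eqP-> ->.
  by rewrite divff.
have [io0 io02] := closed_sqrt (-1 : L).
have [io io2 pow] := quartic_jacobi_power pL io02 b1 g21 jac.
exists io; have [u u2] := closed_sqrt (g + io); have [v v2] := closed_sqrt (g - io).
have [s s2] := closed_sqrt (2%:~R : L).
have uv2 : u ^+ 2 * v ^+ 2 = g ^+ 2 + 1.
  by rewrite u2 v2 mulrC -subr_sqr io2 opprK.
have [u0 v0] : u != 0 /\ v != 0.
  by apply/andP; rewrite -negb_or -mulf_eq0 -sqrf_eq0 exprMn uv2.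
(* The exponents [(n+1)/2] and [n/2] double exactly in their parity cases, since [c + io] and
   [c - io] become [u^2] and [v^2]. *)
have pow' : if odd n then v ^+ n.+1 = io ^+ r * u ^+ n.+1 else u ^+ n = io ^+ r * v ^+ n.
  move: pow; rewrite -/g -u2 -v2; case: ifP => n_odd; rewrite -!exprM mul2n.
    by rewrite (_ : n.+1./2.*2 = n.+1) //; lia.
  by rewrite (_ : n./2.*2 = n) //; lia.
have sixteen0 : 16 != 0 :> L.
  by rewrite (_ : 16 = 2 ^+ 4 :> L) ?expf_neq0 //; ring.
have den0 : 16 * (g ^+ 2 + 1) != 0 by rewrite mulf_neq0.
have den : reduces_to (16 * (c ^+ 2 + 1)) (16 * (g ^+ 2 + 1)) := reducesM (reduces_nat 16) c21.
have [V1 V2] := power_sums_eval pL n_gt0 io2 u2 v2 u0 v0 g0 pow'.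
split=> //.
- rewrite -V1 -mulrA; apply: reducesM.
    rewrite (_ : 2 ^+ n = (legendre 2 n.*2.+1)%:~R); first exact: reduces_int.
    by rewrite (legendre_euler 2 s).
  (* Here [y = g / (u v)], because [(u v)^2 = g^2 + 1]; the second sum uses [y = 1 / (u v)]. *)
  rewrite -(sum_bin4_pchar (x := g ^+ 2 / (16 * (g ^+ 2 + 1))) pL); last first.
    by rewrite -uv2; field; rewrite u0 v0 sixteen0.
  rewrite [2 * _]mulrC mulfK //.
  apply: (reduces_sum _ (fun k => 'C(4 * k, 2 * k)%:R * (c ^+ 2 / (16 * (c ^+ 2 + 1))) ^+ k)
    (fun k => 'C(4 * k, 2 * k)%:R * (g ^+ 2 / (16 * (g ^+ 2 + 1))) ^+ k)) => k.
  by apply: reducesM (reduces_nat _) (reducesX _ (reducesM (reducesX _ cg) (reducesV den den0))).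
- rewrite -V2 -(sum_bin4_pchar (x := (16 * (g ^+ 2 + 1))^-1) pL); last first.
    by rewrite -uv2; field; rewrite u0 v0 sixteen0.
  rewrite [2 * _]mulrC mulfK //.
  apply: (reduces_sum _ (fun k => 'C(4 * k, 2 * k)%:R / (16 * (c ^+ 2 + 1)) ^+ k)
    (fun k => 'C(4 * k, 2 * k)%:R * (16 * (g ^+ 2 + 1))^-1 ^+ k)) => k.
  by rewrite -exprVn; apply: reducesM (reduces_nat _) (reducesX _ (reducesV den den0)).
Qed.

Theorem theorem2p1 (p : nat) (c : rat) :
  prime p -> odd p -> inZloc p c -> ~ ratcong p (c * (c ^+ 2 + 1)) 0 ->
  let S1 := (legendre 2 p)%:~R *
    \sum_(k < (p %/ 4).+1) ('C(4 * k, 2 * k))%:R * (c ^+ 2 / (16 * (c ^+ 2 + 1))) ^+ k in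
  let S2 :=
    \sum_(k < (p %/ 4).+1) ('C(4 * k, 2 * k))%:R / (16 * (c ^+ 2 + 1)) ^+ k in
  [/\ (inQ 0 p c -> ratcong p S1 1),
      (inQ 1 p c -> ratcong p S1 c),
      (inQ 2 p c -> ratcong p S1 (-1)),
      (inQ 3 p c -> ratcong p S1 (- c)) &
  [/\ (inQ 0 p c -> ratcong p S2 1),
      (inQ 1 p c -> ratcong p S2 (- c^-1)),
      (inQ 2 p c -> ratcong p S2 (-1)) &
      (inQ 3 p c -> ratcong p S2 c^-1)]].
Proof.
move=> p_pr p_odd _ cN0 S1 S2.
have [L [phi _]] := countable_algebraic_closure 'F_p.
have pL : p \in [pchar L] by rewrite (fmorph_pchar phi) pchar_Fp.
have two0 : 2 != 0 :> L.
  by rewrite -(dvdn_pcharf pL) gtnNdvd // odd_prime_gt2.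
have redn r : inQ r p c -> exists g io : L,
    [/\ reduces_to c g, g != 0 /\ io != 0, io ^+ 2 = -1,
      reduces_to S1 ((io ^+ r * (g + io) - io ^- r * (g - io)) / (2 * io)) &
      reduces_to S2 ((io ^+ r * (g + io) + io ^- r * (g - io)) / (2 * g))].
  move=> /(sums_reduction pL p_odd cN0)[g [io [cg g0 io2 S1r S2r]]].
  by exists g, io; split=> //; split=> //; rewrite -sqrf_eq0 io2 oppr_eq0 oner_eq0.
have ioV (io : L) : io ^+ 2 = -1 -> io^-1 = - io.
  move=> io2; have io0 : io != 0 by rewrite -sqrf_eq0 io2 oppr_eq0 oner_eq0.
  by apply: (mulfI io0); rewrite divff // mulrN -expr2 io2 opprK.
have io3 (io : L) : io ^+ 2 = -1 -> io ^+ 3 = - io.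
  by move=> io2; rewrite exprS io2 mulrN1.
have red1 : reduces_to 1 (1 : L) := reduces_nat 1.
(* Putting [io ^+ r = 1, io, -1, - io] into the closed forms gives [1, g, -1, - g] for [S1] and
   [1, - 1/g, -1, 1/g] for [S2]. *)
split; last split; move=> /redn[g [io [cg [g0 io0] io2 S1r S2r]]].
- apply: (reduces_ratcong pL S1r); congr (reduces_to _ _) : red1.
  by rewrite expr0 invr1; field; rewrite io0 two0.
- apply: (reduces_ratcong pL S1r); congr (reduces_to _ _) : cg.
  by rewrite expr1 ioV //; field; rewrite io0 two0.
- apply: (reduces_ratcong pL S1r); congr (reduces_to _ _) : (reducesN red1).
  by rewrite io2 invrN1; field; rewrite io0 two0.
- apply: (reduces_ratcong pL S1r); congr (reduces_to _ _) : (reducesN cg).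
  by rewrite io3 // invrN ioV //; field; rewrite io0 two0.
- apply: (reduces_ratcong pL S2r); congr (reduces_to _ _) : red1.
  by rewrite expr0 invr1; field; rewrite g0 two0.
- apply: (reduces_ratcong pL S2r); congr (reduces_to _ _) : (reducesN (reducesV cg g0)).
  rewrite expr1 ioV // (_ : _ + _ = 2 * io ^+ 2); last ring.
  by rewrite io2; field; rewrite g0 two0.
- apply: (reduces_ratcong pL S2r); congr (reduces_to _ _) : (reducesN red1).
  by rewrite io2 invrN1; field; rewrite g0 two0.
- apply: (reduces_ratcong pL S2r); congr (reduces_to _ _) : (reducesV cg g0).
  rewrite io3 // invrN ioV // (_ : _ + _ = - (2 * io ^+ 2)); last ring.
  by rewrite io2; field; rewrite g0 two0.
Qed.
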